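(* Let $\lambda_1\ge\lambda_2\ge\lambda_3\ge 0$ with $\lambda_1+\lambda_2+\lambda_3=1$, $\lambda_3>0$ and $\lambda_1\neq\lambda_3$. Then there is no maximally entangled state in the set $S(\lambda_1,\lambda_2,\lambda_3,0)$.
   Context: $\mathcal{D}$ denotes the set of two-qubit density matrices, i.e. $\rho\in\mathbb{C}^{4\times4}$ with $\rho=\rho^\dagger$, $\rho\ge 0$, $\mathrm{tr}\rho=1$, acting on $\mathbb{C}^2\otimes\mathbb{C}^2$. For eigenvalues $\lambda_1\ge\lambda_2\ge\lambda_3\ge\lambda_4\ge0$ with $\sum_i\lambda_i=1$, $S(\lambda_1,\lambda_2,\lambda_3,\lambda_4)=\{\rho\in\mathcal{D}:\text{the eigenvalues of }\rho\text{ (with multiplicity) are }\lambda_1,\lambda_2,\lambda_3,\lambda_4\}$. For a set $S\subseteq\mathcal{D}$, a state $\rho\in S$ is called a maximally entangled state in $S$ if for every $\sigma\in S$ there exists an LOCC map (a quantum channel implementable by local operations on each qubit and classical communication between the two parties) $\Lambda$ with $\Lambda(\rho)=\sigma$. *)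

(* Defs.v *)
From HB Require Import structures.
From mathcomp Require Import all_boot all_order all_algebra.
From mathcomp Require Import complex mxtens.
From mathcomp Require Import reals.

Set Implicit Arguments.
Unset Strict Implicit.
Unset Printing Implicit Defensive.

Import Order.TTheory GRing.Theory Num.Theory.
Local Open Scope ring_scope.

Section QuantumDefs.

Variable R : realType.
Local Notation C := R[i].

Definition adjmx {m n} (A : 'M[C]_(m, n)) : 'M[C]_(n, m) :=
  (map_mx Num.conj A)^T.

(* two-qubit operators live on C^2 (x) C^2, of dimension 2*2 *)
Notation M4 := 'M[C]_(2 * 2).

Definition density (rho : M4) : Prop :=
  [/\ adjmx rho = rho,
      forall v : 'cV[C]_(2 * 2), 0 <= (adjmx v *m rho *m v) 0 0
    & \tr rho = 1].

(* S(l1,l2,l3,l4): density matrices whose eigenvalues, with multiplicity,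
   are l1,l2,l3,l4, i.e. whose characteristic polynomial is
   (X - l1)(X - l2)(X - l3)(X - l4). *)
Definition Sspec (l1 l2 l3 l4 : R) : M4 -> Prop :=
  fun rho => density rho /\
    char_poly rho = \prod_(l <- [:: l1; l2; l3; l4]) ('X - ((l%:C)%C)%:P).

Definition on_A (K : 'M[C]_2) : M4 := K *t (1%:M : 'M[C]_2).
Definition on_B (K : 'M[C]_2) : M4 := (1%:M : 'M[C]_2) *t K.

Definition kraus_map (Ks : seq M4) (X : M4) : M4 :=
  \sum_(k <- Ks) k *m X *m adjmx k.

(* A local quantum instrument on a qubit: outcomes 'I_n, each outcome
   given by a finite family of Kraus operators; trace preserving overall. *)
Definition instrument n (K : 'I_n -> seq 'M[C]_2) : Prop :=
  \sum_(i < n) \sum_(k <- K i) adjmx k *m k = 1%:M.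

(* Finite-round LOCC channels on two qubits: either do nothing, or one
   party performs a local instrument, broadcasts the outcome i, and the
   protocol continues with an LOCC channel that may depend on i. *)
Inductive LOCC : (M4 -> M4) -> Prop :=
| LOCC_id : LOCC id
| LOCC_A n (K : 'I_n -> seq 'M[C]_2) (next : 'I_n -> M4 -> M4) :
    instrument K -> (forall i, LOCC (next i)) ->
    LOCC (fun X => \sum_(i < n) next i (kraus_map (map on_A (K i)) X))
| LOCC_B n (K : 'I_n -> seq 'M[C]_2) (next : 'I_n -> M4 -> M4) :
    instrument K -> (forall i, LOCC (next i)) ->
    LOCC (fun X => \sum_(i < n) next i (kraus_map (map on_B (K i)) X)).

Definition max_entangled_in (S : M4 -> Prop) (rho : M4) : Prop :=
  S rho /\ forall sigma, S sigma -> exists Lambda, LOCC Lambda /\ Lambda rho = sigma.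

End QuantumDefs.

(* Main.v *)
(** An LOCC map is a sum of terms [K X K^*] with [K = A (x) B].  If it sends
    [rho], of rank three with kernel spanned by [eta], to a state whose kernel
    contains [zeta], then [K^* zeta] is a multiple of [eta] for every [K].
    Reading vectors of C^2 (x) C^2 as 2x2 matrices, [A (x) B] multiplies
    determinants by [det A * det B].  If the image is entangled, some [K] must
    be invertible, for otherwise every [K] produces product vectors only; that
    [K] forces [eta] and [zeta] to be both product or both entangled.  But the
    spectrum class contains entangled states with either kind of kernel: the
    partial transposes of [target s c], whose kernel is spanned by
    [c|00> + s|11>], have a negative minor for [s = 0] and for small [s > 0]. *)

Require Import Defs.
From HB Require Import structures.
From mathcomp Require Import all_boot all_order all_algebra.
From mathcomp Require Import complex mxtens.
From mathcomp Require Import reals.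
From mathcomp Require Import ring lra.
Set Implicit Arguments.
Unset Strict Implicit.

Import Order.TTheory GRing.Theory Num.Theory.
Local Open Scope ring_scope.

(** * Characteristic polynomials, determinants and tensors of matrices *)

Lemma char_poly_similar (R : comNzRingType) n (P Q A : 'M[R]_n) :
  Q *m P = 1%:M -> char_poly (Q *m A *m P) = char_poly A.
Proof.
move=> QP; have detQP : \det (map_mx polyC Q) * \det (map_mx polyC P) = 1.
  by rewrite -det_mulmx -map_mxM QP map_mx1 det1.
have -> : char_poly (Q *m A *m P) =
    \det (map_mx polyC Q *m char_poly_mx A *m map_mx polyC P).
  rewrite /char_poly /char_poly_mx mulmxBr mulmxBl mul_mx_scalar -scalemxAl.
  by rewrite -!map_mxM QP map_mx1 scalemx1.
by rewrite !det_mulmx mulrAC detQP mul1r.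
Qed.

Lemma det_mx22 (R : comNzRingType) (A : 'M[R]_2) :
  \det A = A 0 0 * A 1 1 - A 0 1 * A 1 0.
Proof.
rewrite (expand_det_row _ 0) !big_ord_recl big_ord0 /cofactor !det_mx11 !mxE.
have -> : lift 0 0 = 1 :> 'I_2 by exact: val_inj.
have -> : lift 1 0 = 0 :> 'I_2 by exact: val_inj.
rewrite /= addr0; ring.
Qed.

Lemma tensmx11 (R : pzRingType) m n : (1%:M : 'M[R]_m) *t (1%:M : 'M[R]_n) = 1%:M.
Proof.
apply/matrixP=> i j; case: (mxtens_indexP i) => i1 i2; case: (mxtens_indexP j) => j1 j2.
by rewrite tensmxE !mxE (can_eq (@mxtens_indexK m n)) xpair_eqE -natrM mulnb.
Qed.

(** * Adjoints, the spectral theorem and quadratic forms *)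

Section Adjoint.

Variable R : realType.
Local Notation C := R[i].

Lemma adjmxM m n p (A : 'M[C]_(m, n)) (B : 'M[C]_(n, p)) :
  adjmx (A *m B) = adjmx B *m adjmx A.
Proof. by rewrite /adjmx map_mxM trmx_mul. Qed.

Lemma adjmxK m n (A : 'M[C]_(m, n)) : adjmx (adjmx A) = A.
Proof. by apply/matrixP=> i j; rewrite !mxE conjCK. Qed.

Lemma adjmx_tens m n p q (A : 'M[C]_(m, n)) (B : 'M[C]_(p, q)) :
  adjmx (A *t B) = adjmx A *t adjmx B.
Proof. by rewrite /adjmx map_mxT trmx_tens. Qed.

Lemma det_adjmx n (A : 'M[C]_n) : \det (adjmx A) = Num.conj (\det A).
Proof. by rewrite /adjmx det_tr det_map_mx. Qed.

Lemma hermitian_diagonalization n (A : 'M[C]_n) : adjmx A = A ->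
  exists P : 'M[C]_n, exists d : 'I_n -> C,
    [/\ adjmx P *m P = 1%:M,
        A = \sum_j d j *: (col j (adjmx P) *m adjmx (col j (adjmx P)))
      & char_poly A = \prod_j ('X - (d j)%:P)].
Proof.
move=> Aherm.
have adjE k (M : 'M[C]_k) : map_mx Num.conj M^T = adjmx M by rewrite /adjmx map_trmx.
have /orthomx_spectralP Adiag : A \is spectral.normalmx.
  by apply/spectral.normalmxP; rewrite adjE Aherm.
have Punit := spectral.spectral_unit A.
have /spectral.invmx_unitary := spectral.spectral_unitarymx A.
rewrite adjE => Pinv.
set P := spectral.spectralmx A in Adiag Punit Pinv.
set d := spectral.spectral_diag A in Adiag.
exists P, (fun j => d 0 j); split.
- by rewrite -Pinv mulVmx.
- rewrite {1}Adiag Pinv; apply/matrixP=> i k; rewrite summxE !mxE.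
  apply: eq_bigr => j _; rewrite mul_mx_diag !mxE big_ord1 !mxE conjCK.
  by rewrite mulrCA mulrA.
have -> : char_poly A = char_poly (diag_mx d).
  by rewrite Adiag char_poly_similar // mulVmx.
rewrite char_poly_trig ?diag_mx_is_trig //.
by apply: eq_bigr => j _; rewrite mxE eqxx mulr1n.
Qed.

Lemma quadratic_rank1 n (v w : 'cV[C]_n) :
  (adjmx w *m (v *m adjmx v) *m w) 0 0 = `|(adjmx v *m w) 0 0| ^+ 2.
Proof.
rewrite normCK !mulmxA -mulmxA mxE big_ord1 mulrC; congr (_ * _).
have <- : adjmx (adjmx v *m w) = adjmx w *m v by rewrite adjmxM adjmxK.
by rewrite !mxE.
Qed.

Lemma quadratic_rank3 n (a b c : C) (x y z w : 'cV[C]_n) :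
  (adjmx w *m (a *: (x *m adjmx x) + b *: (y *m adjmx y) + c *: (z *m adjmx z))
    *m w) 0 0 =
  a * `|(adjmx x *m w) 0 0| ^+ 2 + b * `|(adjmx y *m w) 0 0| ^+ 2
    + c * `|(adjmx z *m w) 0 0| ^+ 2.
Proof.
have: forall q : 'M[C]_n -> C, {morph q : A B / A + B} ->
    (forall k A, q (k *: A) = k * q A) ->
    q (a *: (x *m adjmx x) + b *: (y *m adjmx y) + c *: (z *m adjmx z)) =
    a * q (x *m adjmx x) + b * q (y *m adjmx y) + c * q (z *m adjmx z).
  by move=> q qD qZ; rewrite !qD !qZ.
move=> /(_ (fun A => (adjmx w *m A *m w) 0 0)) /= linq; rewrite linq.
- by congr (_ * _ + _ * _ + _ * _); exact: quadratic_rank1.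
- by move=> A B; rewrite mulmxDr mulmxDl mxE.
- by move=> k A; rewrite -scalemxAr -scalemxAl mxE.
Qed.

End Adjoint.

(** * Kernels of rank-three states, product Kraus operators, the witness *)

Section TwoQubits.

Variable R : realType.
Local Notation C := R[i].
Local Notation M4 := 'M[C]_(2 * 2).
Local Notation V4 := 'cV[C]_(2 * 2).

(** The determinant of this matrix vanishes exactly when [x] is a product vector. *)
Definition coef_mx (x : V4) : 'M[C]_2 := \matrix_(i, j) x (mxtens_index (i, j)) 0.

Lemma coef_mxZ c (x : V4) : coef_mx (c *: x) = c *: coef_mx x.
Proof. by apply/matrixP=> i j; rewrite !mxE. Qed.

Lemma coef_mx0 : coef_mx 0 = 0.
Proof. by apply/matrixP=> i j; rewrite !mxE. Qed.

Lemma coef_mx_tens (A B : 'M[C]_2) (x : V4) :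
  coef_mx ((A *t B) *m x) = A *m coef_mx x *m B^T.
Proof.
apply/matrixP=> i j; rewrite !mxE.
under [RHS]eq_bigr do rewrite mxE mulr_suml.
rewrite exchange_big pair_big /= (reindex (@mxtens_index 2 2)) /=; last first.
  by exists (@mxtens_unindex 2 2) => k _; rewrite (mxtens_indexK, mxtens_unindexK).
apply: eq_bigr => -[k l] _; rewrite tensmxE !mxE /=; ring.
Qed.

Lemma det_coef_mx_tens (A B : 'M[C]_2) (x : V4) :
  \det (coef_mx ((A *t B) *m x)) = \det A * \det B * \det (coef_mx x).
Proof. by rewrite coef_mx_tens !det_mulmx det_tr mulrAC. Qed.

Lemma Sspec_diagonalization (l1 l2 l3 : R) (rho : M4) :
  0 < l1 -> 0 < l2 -> 0 < l3 -> Sspec l1 l2 l3 0 rho ->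
  exists P : M4, exists d : 'I_(2 * 2) -> C, exists j0,
    [/\ adjmx P *m P = 1%:M,
        rho = \sum_j d j *: (col j (adjmx P) *m adjmx (col j (adjmx P))),
        forall j, 0 <= d j
      & forall j, (d j == 0) = (j == j0)].
Proof.
move=> l1p l2p l3p [[herm _ _] chi].
have [P [d [PP rhoE chiE]]] := hermitian_diagonalization herm.
have spec : perm_eq [seq d j | j <- index_enum 'I_(2 * 2)]
    [seq ((l%:C)%C : C) | l <- [:: l1; l2; l3; 0]].
  by apply: prod_XsubC_eq; rewrite !big_map -chiE chi.
have lC_eq0 (l : R) : ((l%:C)%C == 0 :> C) = (l == 0) by rewrite fmorph_eq0.
(* The eigenvalues agree with the list only up to order, so the index of the zero one is found by
   counting: 0 occurs once. *)
have [|j0 j0E] := @mem_card1 _ [pred j | d j == 0].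
  rewrite cardE /enum_mem size_filter.
  have /permP/(_ (pred1 0)) := spec; rewrite count_map /= !lC_eq0 eqxx.
  by rewrite !gt_eqF.
exists P, d, j0; split=> // j.
have : d j \in [seq d j | j <- index_enum 'I_(2 * 2)] by rewrite map_f ?mem_index_enum.
rewrite (perm_mem spec) => /mapP[l lin ->]; rewrite ler0c.
by move: lin; rewrite !inE => /or4P[] /eqP-> //; exact: ltW.
Qed.

(** In an eigenbasis the form is a sum of terms [d j * |(P w)_j|^2], all nonnegative; if it
    vanishes, only the coordinate [j0] of [P *m w] survives. *)
Lemma kernel_spanned (l1 l2 l3 : R) (rho : M4) :
  0 < l1 -> 0 < l2 -> 0 < l3 -> Sspec l1 l2 l3 0 rho ->
  exists eta : V4, forall w : V4,
    (adjmx w *m rho *m w) 0 0 = 0 -> exists c, w = c *: eta.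
Proof.
move=> l1p l2p l3p /(Sspec_diagonalization l1p l2p l3p).
move=> [P [d [j0 [PP rhoE d0 dE]]]].
exists (col j0 (adjmx P)) => w; rewrite rhoE mulmx_sumr mulmx_suml summxE.
under eq_bigr do rewrite -scalemxAr -scalemxAl mxE quadratic_rank1.
move/psumr_eq0P => /= H; exists ((P *m w) j0 0).
have Pw0 j : j != j0 -> (P *m w) j 0 = 0.
  move=> jN; have /eqP := H (fun i _ => mulr_ge0 (d0 i) (exprn_ge0 2 (normr_ge0 _))) j isT.
  rewrite mulf_eq0 dE (negPf jN) expf_eq0 /= normr_eq0 => /eqP <-.
  by rewrite !mxE; apply: eq_bigr => k _; rewrite !mxE conjCK.
rewrite -[LHS]mul1mx -PP -mulmxA; move: (P *m w) Pw0 => u u0.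
apply/matrixP=> i k; rewrite ord1 !mxE.
by rewrite (bigD1 j0) //= big1 ?addr0 ?mxE 1?mulrC // => j jN; rewrite u0 ?mulr0.
Qed.

Definition sep_map (L : M4 -> M4) :=
  exists s : seq ('M[C]_2 * 'M[C]_2), forall X,
    L X = \sum_(k <- s) (k.1 *t k.2) *m X *m adjmx (k.1 *t k.2).

(** Kraus operators of a composite are pairwise products, and a product of tensors is a tensor of
    products. *)
Lemma sep_map_comp (I : Type) (s : seq I) (F : I -> 'M[C]_2 * 'M[C]_2) L :
  sep_map L ->
  sep_map (fun X => L (\sum_(k <- s) ((F k).1 *t (F k).2) *m X *m adjmx ((F k).1 *t (F k).2))).
Proof.
move=> [t tE]; exists [seq (k.1 *m (F l).1, k.2 *m (F l).2) | k <- t, l <- s].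
move=> X; rewrite tE big_allpairs_dep /=; apply: eq_bigr => k _.
rewrite mulmx_sumr mulmx_suml; apply: eq_bigr => l _.
by rewrite -tensmx_mul adjmxM !mulmxA.
Qed.

Lemma sep_map_sum n (L : 'I_n -> M4 -> M4) :
  (forall i, sep_map (L i)) -> sep_map (fun X => \sum_i L i X).
Proof.
move=> /fin_all_exists [s sE]; exists (flatten [seq s i | i <- enum 'I_n]) => X.
rewrite big_flatten big_map big_enum /=.
by apply: eq_bigr => i _; rewrite sE.
Qed.

Lemma LOCC_sep (L : M4 -> M4) : LOCC L -> sep_map L.
Proof.
elim=> [|n K next _ _ IH|n K next _ _ IH].
- exists [:: (1%:M, 1%:M)] => X; rewrite big_seq1 /= tensmx11 mul1mx.
  by rewrite /adjmx map_mx1 trmx1 mulmx1.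
- apply: sep_map_sum => i.
  have [s sE] := sep_map_comp (K i) (fun k => (k, 1%:M)) (IH i).
  by exists s => X; rewrite -sE /kraus_map big_map.
- apply: sep_map_sum => i.
  have [s sE] := sep_map_comp (K i) (fun k => (1%:M, k)) (IH i).
  by exists s => X; rewrite -sE /kraus_map big_map.
Qed.

(* The expectation of the entanglement witness obtained by partially transposing
   the projector on [a|00> - b|11>]. *)
Definition witness (a b : C) (X : M4) : C :=
  a ^+ 2 * X (mxtens_index (0, 0)) (mxtens_index (0, 0))
  + b ^+ 2 * X (mxtens_index (1, 1)) (mxtens_index (1, 1))
  - a * b * (X (mxtens_index (0, 1)) (mxtens_index (1, 0))
             + X (mxtens_index (1, 0)) (mxtens_index (0, 1))).

Lemma witness_sum I (s : seq I) a b (F : I -> M4) :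
  witness a b (\sum_(k <- s) F k) = \sum_(k <- s) witness a b (F k).
Proof.
rewrite /witness !summxE -big_split /= !mulr_sumr -big_split /= -sumrB.
by [].
Qed.

Lemma witnessZ a b c (X : M4) : witness a b (c *: X) = c * witness a b X.
Proof. rewrite /witness !mxE; ring. Qed.

(** A zero determinant gives [|x00| |x11| = |x01| |x10|], which bounds the cross terms and leaves at
    least the square of [a |x00| - b |x11|]. *)
Lemma witness_product (a b : C) (x : V4) : 0 <= a -> 0 <= b ->
  \det (coef_mx x) = 0 -> 0 <= witness a b (x *m adjmx x).
Proof.
move=> a0 b0; rewrite /witness det_mx22 !mxE !big_ord1 !mxE.
set x00 := x _ _; set x11 := x _ _; set x01 := x _ _; set x10 := x _ _.
move/subr0_eq => prodE.
have normE : `|x00| * `|x11| = `|x01 * Num.conj x10|.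
  by rewrite normrM norm_conjC -!normrM prodE.
have cross : x01 * Num.conj x10 + x10 * Num.conj x01 <= 2 * (`|x00| * `|x11|).
  have -> : x10 * Num.conj x01 = Num.conj (x01 * Num.conj x10).
    by rewrite rmorphM /= conjCK mulrC.
  rewrite normE; set z := _ * _.
  apply: le_trans (real_ler_norm _) _.
    by apply/CrealP; rewrite rmorphD /= conjCK addrC.
  by rewrite (le_trans (ler_normD _ _)) // norm_conjC mulr2n mulrDl mul1r.
rewrite -!normCK subr_ge0; apply: le_trans (ler_wpM2l (mulr_ge0 a0 b0) cross) _.
rewrite -subr_ge0.
have -> : a ^+ 2 * `|x00| ^+ 2 + b ^+ 2 * `|x11| ^+ 2 -
    a * b * (2 * (`|x00| * `|x11|)) = (a * `|x00| - b * `|x11|) ^+ 2 by ring.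
by apply: real_exprn_even_ge0 => //; rewrite rpredB ?ger0_real ?mulr_ge0.
Qed.

(** A singular local factor sends every eigenvector of [rho] to a product vector. *)
Lemma witness_singular (a b : C) (l1 l2 l3 : R) (rho : M4) (A B : 'M[C]_2) :
  0 <= a -> 0 <= b -> 0 < l1 -> 0 < l2 -> 0 < l3 -> Sspec l1 l2 l3 0 rho ->
  \det A * \det B = 0 ->
  0 <= witness a b ((A *t B) *m rho *m adjmx (A *t B)).
Proof.
move=> a0 b0 l1p l2p l3p /(Sspec_diagonalization l1p l2p l3p).
move=> [P [d [j0 [_ -> d0 _]]]] AB0.
rewrite mulmx_sumr mulmx_suml witness_sum sumr_ge0 // => j _.
rewrite -scalemxAr -scalemxAl witnessZ mulr_ge0 //.
set v := col _ _; set K := A *t B.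
have -> : K *m (v *m adjmx v) *m adjmx K = (K *m v) *m adjmx (K *m v).
  by rewrite adjmxM !mulmxA.
by rewrite witness_product // det_coef_mx_tens AB0 mul0r.
Qed.

Lemma regular_kraus (a b : C) (l1 l2 l3 : R) (rho : M4) (eta zeta : V4) L :
  0 <= a -> 0 <= b -> 0 < l1 -> 0 < l2 -> 0 < l3 -> Sspec l1 l2 l3 0 rho ->
  (forall w : V4, (adjmx w *m rho *m w) 0 0 = 0 -> exists c, w = c *: eta) ->
  sep_map L -> witness a b (L rho) < 0 ->
  (adjmx zeta *m L rho *m zeta) 0 0 = 0 ->
  exists A B : 'M[C]_2, exists c,
    \det A * \det B != 0 /\ (A *t B) *m zeta = c *: eta.
Proof.
move=> a0 b0 l1p l2p l3p rhoS ker [s sE]; rewrite sE => neg zeta0.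
have [/allP sing|/allPn[[A B] ABs /= AB0]] :=
    boolP (all (fun k => \det k.1 * \det k.2 == 0) s).
  suff : 0 <= witness a b (L rho) by rewrite sE => /le_lt_trans/(_ neg); rewrite ltxx.
  rewrite sE witness_sum big_seq sumr_ge0 // => k /sing/eqP.
  exact: witness_singular rhoS.
have quadE (k : 'M[C]_2 * 'M[C]_2) (K := k.1 *t k.2) :
    (adjmx zeta *m (K *m rho *m adjmx K) *m zeta) 0 0 =
    (adjmx (adjmx K *m zeta) *m rho *m (adjmx K *m zeta)) 0 0.
  by rewrite adjmxM adjmxK !mulmxA.
have [c cE] : exists c, adjmx (A *t B) *m zeta = c *: eta.
  apply: ker; rewrite -(quadE (A, B)).
  move: zeta0; rewrite mulmx_sumr mulmx_suml summxE => /eqP.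
  rewrite psumr_eq0 => [/allP/(_ _ ABs)/eqP//|k _].
  by rewrite quadE; case: rhoS => -[].
(* Adjoints appear because the form of [K rho K^*] at [zeta] is that of [rho] at [K^* zeta]. *)
exists (adjmx A), (adjmx B), c; split; last by rewrite -adjmx_tens.
by rewrite !det_adjmx -rmorphM conjC_eq0.
Qed.

End TwoQubits.

(** * Matrices of X shape *)

Section XStates.

Variable R : comNzRingType.

Definition vec4 (a b c d : R) : 'cV[R]_(2 * 2) := \col_i [:: a; b; c; d]`_i.

(** Basis order is 00, 01, 10, 11. The ring is left general so that the characteristic matrix is
    again an [xmx], over polynomials. *)
Definition xmx (p r u q m : R) : 'M[R]_(2 * 2) :=
  \matrix_(i, j) (nth [::] [:: [:: p; 0; 0; u]; [:: 0; m; q; 0];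
                                [:: 0; q; m; 0]; [:: u; 0; 0; r]] i)`_j.

Lemma det_xmx p r u q m :
  \det (xmx p r u q m) = (p * r - u ^+ 2) * (m ^+ 2 - q ^+ 2).
Proof.
rewrite (@expand_det_row _ 4 _ ord0) !big_ord_recl big_ord0 /cofactor.
rewrite ![xmx _ _ _ _ _ _ _]mxE /= !mul0r !add0r addr0.
rewrite !(@expand_det_row _ 3 _ ord0) !big_ord_recl !big_ord0 /cofactor.
rewrite !det_mx22 !mxE /=; ring.
Qed.

End XStates.

Lemma char_poly_xmx (R : comNzRingType) (p r u q m : R) :
  char_poly (xmx p r u q m) =
  (('X - p%:P) * ('X - r%:P) - u%:P ^+ 2) * (('X - m%:P) ^+ 2 - q%:P ^+ 2).
Proof.
rewrite /char_poly.
have -> : char_poly_mx (xmx p r u q m) =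
    xmx ('X - p%:P) ('X - r%:P) (- u%:P) (- q%:P) ('X - m%:P).
  apply/matrixP=> -[[|[|[|[|//]]]] ?] [[|[|[|[|//]]]] ?];
  by rewrite !mxE -val_eqE /= ?polyC0 ?mulr1n ?sub0r ?oppr0.
by rewrite det_xmx !sqrrN.
Qed.

(** * Entangled states of the class with prescribed kernel *)

Section Targets.

Variable R : realType.
Variables l1 l2 l3 s c : R.
Hypotheses (l1_gt0 : 0 < l1) (l2_gt0 : 0 < l2) (l3_gt0 : 0 < l3).
Hypotheses (sum_l : l1 + l2 + l3 = 1) (unit_sc : s ^+ 2 + c ^+ 2 = 1).
Local Notation C := R[i].
Local Notation cplx A := (map_mx (real_complex R) A).

Lemma adjmx_real m n (A : 'M[R]_(m, n)) : adjmx (cplx A) = cplx A^T.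
Proof.
apply/matrixP=> i j; rewrite !mxE; apply: conj_Creal.
by rewrite complex_real.
Qed.

(* [l1] and [l3] on [(|01> +- |10>)/sqrt 2], [l2] on [-s|00> + c|11>] and
   [0] on [c|00> + s|11>]. *)
Definition target : 'M[R]_(2 * 2) :=
  xmx (l2 * s ^+ 2) (l2 * c ^+ 2) (- (l2 * (s * c))) ((l1 - l3) / 2) ((l1 + l3) / 2).

(** Unnormalised Bell vectors with halved weights avoid square roots; positivity and the kernel are
    read off this form. *)
Lemma target_rank1 :
  target = (l1 / 2) *: (vec4 0 1 1 0 *m (vec4 0 1 1 0)^T)
    + (l3 / 2) *: (vec4 0 1 (-1) 0 *m (vec4 0 1 (-1) 0)^T)
    + l2 *: (vec4 (- s) 0 0 c *m (vec4 (- s) 0 0 c)^T).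
Proof.
apply/matrixP=> -[[|[|[|[|//]]]] ?] [[|[|[|[|//]]]] ?];
by rewrite !mxE !big_ord1 !mxE /=; field.
Qed.

Lemma target_quadratic (w : 'cV[C]_(2 * 2)) :
  (adjmx w *m cplx target *m w) 0 0 =
    (((l1 / 2)%:C)%C * `|(adjmx (cplx (vec4 0 1 1 0)) *m w) 0 0| ^+ 2
    + ((l3 / 2)%:C)%C * `|(adjmx (cplx (vec4 0 1 (-1) 0)) *m w) 0 0| ^+ 2
    + (l2%:C)%C * `|(adjmx (cplx (vec4 (- s) 0 0 c)) *m w) 0 0| ^+ 2).
Proof.
by rewrite target_rank1 !map_mxD !map_mxZ !map_mxM /= -!adjmx_real quadratic_rank3.
Qed.

Lemma target_kernel :
  (adjmx (cplx (vec4 c 0 0 s)) *m cplx target *m cplx (vec4 c 0 0 s)) 0 0 = 0.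
Proof.
have ortho (v : 'cV[R]_(2 * 2)) : (v^T *m vec4 c 0 0 s) 0 0 = 0 ->
    `|(adjmx (cplx v) *m cplx (vec4 c 0 0 s)) 0 0| ^+ 2 = 0 :> C.
  by move=> v0; rewrite adjmx_real -map_mxM mxE v0 rmorph0 normr0 expr0n.
rewrite target_quadratic !ortho ?mulr0 ?addr0 // !mxE !big_ord_recl big_ord0 !mxE /=; ring.
Qed.

Lemma target_Sspec : Sspec l1 l2 l3 0 (cplx target).
Proof.
split; first split.
- rewrite adjmx_real; congr map_mx; rewrite target_rank1.
  by rewrite !linearD !linearZ /= !trmx_mul !trmxK.
- move=> w; rewrite target_quadratic !addr_ge0 // mulr_ge0 ?exprn_ge0 //;
  by rewrite ler0c ?divr_ge0 ?ltW.
- rewrite trace_map_mx /mxtrace !big_ord_recl big_ord0 !mxE /=.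
  rewrite -[RHS](rmorph1 (real_complex R)); congr (real_complex _ _).
  transitivity (l1 + l2 * (s ^+ 2 + c ^+ 2) + l3); first by field.
  by rewrite unit_sc mulr1.
- rewrite -map_char_poly char_poly_xmx.
  rewrite !big_cons big_nil rmorph0.
  have -> : ('X - (l2 * s ^+ 2)%:P) * ('X - (l2 * c ^+ 2)%:P) - (- (l2 * (s * c)))%:P ^+ 2
      = 'X * ('X - l2%:P) :> {poly R}.
    (* Inserting [s ^+ 2 + c ^+ 2] for 1 turns the claim into a polynomial identity. *)
    rewrite -[l2 in RHS]mulr1 -unit_sc; ring.
  have -> : ('X - ((l1 + l3) / 2)%:P) ^+ 2 - ((l1 - l3) / 2)%:P ^+ 2
      = ('X - l1%:P) * ('X - l3%:P) :> {poly R}.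
    set m := (l1 + l3) / 2; set q := (l1 - l3) / 2.
    have -> : l1 = m + q by rewrite /m /q; field.
    have -> : l3 = m - q by rewrite /m /q; field.
    clearbody m q; ring.
  rewrite !rmorphM !rmorphB /= !map_polyX !map_polyC /=; ring.
Qed.

Lemma target_witness (a b : R) :
  witness (a%:C)%C (b%:C)%C (cplx target) =
  ((a ^+ 2 * (l2 * s ^+ 2) + b ^+ 2 * (l2 * c ^+ 2) - a * b * (l1 - l3))%:C)%C.
Proof.
rewrite /witness !mxE /= -!(rmorphXn, rmorphM, rmorphD, rmorphB) /=.
by congr (real_complex _ _); field.
Qed.

Lemma target_entangled : l3 < l1 -> 0 < c -> `|l2 * (s * c)| < (l1 - l3) / 2 ->
  exists a b : C, [/\ 0 <= a, 0 <= b & witness a b (cplx target) < 0].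
Proof.
move=> l31 c0 sc.
(* With [p = l2 s^2], [r = l2 c^2], [q = (l1 - l3) / 2], the witness is [a^2 p + b^2 r - 2 a b q];
   at [a = r], [b = q] it equals [r (p r - q^2)], negative by hypothesis. *)
exists ((l2 * c ^+ 2)%:C)%C, (((l1 - l3) / 2)%:C)%C.
have r0 : 0 < l2 * c ^+ 2 by rewrite mulr_gt0 ?exprn_gt0.
have q0 : 0 < (l1 - l3) / 2 by rewrite divr_gt0 ?subr_gt0.
rewrite !ler0c !ltW // target_witness; split=> //.
rewrite -[0](rmorph0 (real_complex R)) ltcR.
have : (l2 * (s * c)) ^+ 2 < ((l1 - l3) / 2) ^+ 2.
  by rewrite -real_normK ?num_real // ltrXn2r // ltW.
rewrite -subr_gt0 => /(mulr_gt0 r0).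
rewrite -oppr_lt0 => /(le_lt_trans _); apply.
by rewrite le_eqVlt; apply/orP; left; apply/eqP; field.
Qed.

End Targets.

(** * Contradiction between two targets *)

Theorem theorem2 (R : realType) (l1 l2 l3 : R) :
  l2 <= l1 -> l3 <= l2 -> 0 <= l3 -> l1 + l2 + l3 = 1 ->
  0 < l3 -> l1 != l3 ->
  ~ (exists rho, max_entangled_in (Sspec l1 l2 l3 0) rho).
Proof.
move=> l21 l32 _ sum_l l3p l13 [rho [rhoS conv]].
have l2p : 0 < l2 by exact: lt_le_trans l32.
have l1p : 0 < l1 by exact: lt_le_trans l21.
have l31 : l3 < l1 by rewrite lt_neqAle eq_sym l13 (le_trans l32).
have [eta ker] := kernel_spanned l1p l2p l3p rhoS.
have regular s c : s ^+ 2 + c ^+ 2 = 1 -> 0 < c ->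
    `|l2 * (s * c)| < (l1 - l3) / 2 ->
    exists A B : 'M[R[i]]_2, exists k, \det A * \det B != 0 /\
      (A *t B) *m map_mx (real_complex R) (vec4 c 0 0 s) = k *: eta.
  move=> sc1 c0 sc.
  have [L [/LOCC_sep Lsep LE]] := conv _ (target_Sspec l1p l2p l3p sum_l sc1).
  have [a [b [a0 b0 neg]]] := target_entangled l2p l31 c0 sc.
  apply: (regular_kraus a0 b0 l1p l2p l3p rhoS ker Lsep); rewrite LE //.
  exact: target_kernel.
have det_zeta s c : \det (coef_mx (map_mx (real_complex R) (vec4 c 0 0 s))) =
    ((c * s)%:C)%C.
  by rewrite det_mx22 !mxE /= rmorph0 mulr0 subr0 rmorphM.
(* The target with kernel [|00>] forces [eta] to be a product vector. *)
have det_eta : \det (coef_mx eta) = 0.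
  have [||| A [B [k [AB kE]]]] := regular 0 1.
  - by rewrite expr0n expr1n add0r.
  - exact: ltr01.
  - by rewrite mul0r mulr0 normr0 divr_gt0 ?subr_gt0.
  have := det_coef_mx_tens A B (map_mx (real_complex R) (vec4 1 0 0 0)).
  rewrite kE det_zeta mulr0 rmorph0 mulr0 coef_mxZ detZ => /eqP.
  rewrite mulf_eq0 expf_eq0 /= => /orP[/eqP k0|/eqP//].
  (* If [k = 0], the invertible [A *t B] would kill the nonzero vector [|00>]. *)
  move: kE; rewrite k0 scale0r => /(congr1 (@coef_mx R)).
  rewrite coef_mx_tens coef_mx0.
  move: AB; rewrite mulf_eq0 negb_or -!unitfE -!unitmxE -(unitmx_tr B) => /andP[Au Bu].
  move=> /(congr1 (mulmx^~ (invmx B^T))); rewrite mulmxK // mul0mx.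
  move=> /(congr1 (mulmx (invmx A))); rewrite mulKmx // mulmx0.
  move=> /matrixP/(_ 0 0)/eqP; rewrite !mxE /= rmorph1 oner_eq0 //.
(* Any [0 < s < 1] with [s <= (l1 - l3) / 2] would do. *)
pose s := (l1 - l3) / 2; pose c := Num.sqrt (1 - s ^+ 2).
have s0 : 0 < s by rewrite divr_gt0 ?subr_gt0.
have s1 : s < 1 by rewrite /s; lra.
have s21 : 0 < 1 - s ^+ 2 by rewrite subr_gt0 expr_lt1 // ltW.
have c0 : 0 < c by rewrite sqrtr_gt0.
have sc1 : s ^+ 2 + c ^+ 2 = 1 by rewrite sqr_sqrtr ?ltW // addrC subrK.
have [||| A [B [k [AB kE]]]] := regular s c => //.
  (* As [s] is itself the bound, the inequality reduces to [l2 * c < 1]. *)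
  have lsc_ge0 : 0 <= l2 * (s * c) by do 2?apply: mulr_ge0; exact: ltW.
  rewrite -/s (ger0_norm lsc_ge0) mulrCA gtr_pMr //.
  have : c ^+ 2 <= 1 by rewrite -sc1 lerDr sqr_ge0.
  rewrite expr_le1 ?(ltW c0) // => c1.
  have l2_lt1 : l2 < 1 by lra.
  exact: le_lt_trans (ler_piMr (ltW l2p) c1) l2_lt1.
(* Now [det A * det B * (c * s)] equals [k ^+ 2 * det eta = 0], although every factor on the left is
   nonzero. *)
have := det_coef_mx_tens A B (map_mx (real_complex R) (vec4 c 0 0 s)).
rewrite kE det_zeta coef_mxZ detZ det_eta mulr0 => /esym/eqP.
rewrite mulf_eq0 (negPf AB) /= fmorph_eq0 mulf_eq0.
by rewrite !gt_eqF.
Qed.
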